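(* Let $R$ be a commutative ring with nonzero identity and let $M_1$ and $M_2$ be nonzero $R$-modules such that at least one of them is noncyclic. Then $M=M_1\oplus M_2$ is a pseudo simple $R$-module if and only if $M_1$ and $M_2$ are pseudo simple $R$-modules and $\operatorname{ann}(M_1)=\operatorname{ann}(M_2)$ is a maximal ideal of $R$.
   Context: For a commutative ring $R$ with nonzero identity (not necessarily a domain), an $R$-module $M$ is called pseudo simple if the submodule $Rm$ is simple for every $0\neq m\in M$ with $Rm\neq M$. $\operatorname{ann}(M)=\{r\in R: rM=0\}$. *)

(* Defs.v *)
(* Submodules and ideals are Prop-valued classical sets, so that they need not
   be decidable. *)
From mathcomp Require Export all_boot all_order all_algebra.
From mathcomp Require Export boolp classical_sets.

Set Implicit Arguments.
Unset Strict Implicit.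
Unset Printing Implicit Defensive.

Import GRing.Theory.
Local Open Scope classical_set_scope.
Local Open Scope ring_scope.

Definition nonzero_module (R : comNzRingType) (M : lmodType R) : Prop :=
  exists m : M, m <> 0.

Definition is_submodule (R : comNzRingType) (M : lmodType R) (N : set M) : Prop :=
  submod_closed [in N].

(* Simplicity of the submodule N as a module in its own right: its submodules
   are exactly the submodules of M contained in N. *)
Definition simple_submodule (R : comNzRingType) (M : lmodType R) (N : set M)
    : Prop :=
  [/\ is_submodule N,
      N <> [set 0] &
      forall L : set M, is_submodule L -> L `<=` N -> L = [set 0] \/ L = N].

Definition cyclic_submodule (R : comNzRingType) (M : lmodType R) (m : M) : set M :=
  [set r *: m | r in [set: R]].

Definition cyclic_module (R : comNzRingType) (M : lmodType R) : Prop :=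
  exists m : M, cyclic_submodule m = [set: M].

Definition pseudo_simple (R : comNzRingType) (M : lmodType R) : Prop :=
  forall m : M, m <> 0 -> cyclic_submodule m <> [set: M] ->
    simple_submodule (cyclic_submodule m).

Definition ann (R : comNzRingType) (M : lmodType R) : set R :=
  [set r | forall m : M, r *: m = 0].

(* idealr_closed includes properness: 1 \notin I. *)
Definition maximal_ideal (R : comNzRingType) (I : set R) : Prop :=
  idealr_closed [in I] /\
  forall J : set R, idealr_closed [in J] -> I `<=` J -> J = I.

(* Main.v *)
(* When M1 or M2 is noncyclic so is M, hence M is pseudo simple exactly when Rm
   is simple for every nonzero m in M, i.e. when every nonzero r m generates Rm.
   For nonzero x in M1 and y in M2, simplicity of R(x,y) forces
   ann x = ann y: if r x = 0 but r y <> 0, then (0, r y) generates (x, y) and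
   x = 0. So all these annihilators equal ann M1 = ann M2, which is maximal
   because Rx = R/ann x is simple. Conversely, a module whose annihilator is
   maximal is a vector space over the residue field. *)
Require Import Defs.

Set Implicit Arguments.
Unset Strict Implicit.
Unset Printing Implicit Defensive.

Import GRing.Theory.
Local Open Scope classical_set_scope.
Local Open Scope ring_scope.

(** The elementwise form of [pseudo_simple] without the exemption for [Rm = M]; [r *: m <> 0]
    already forces [m <> 0]. *)
Definition cyclics_simple (R : comNzRingType) (M : lmodType R) : Prop :=
  forall (m : M) (r : R), r *: m <> 0 -> exists s, s *: (r *: m) = m.

Lemma cyclic_is_submodule (R : comNzRingType) (M : lmodType R) (m : M) :
  is_submodule (cyclic_submodule m).
Proof.
split; first by apply: mem_set; exists 0; rewrite ?scale0r.
move=> a u v /set_mem[r _ <-] /set_mem[s _ <-]; apply: mem_set.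
by exists (a * r + s) => //; rewrite scalerDl scalerA.
Qed.

Lemma mem_cyclic (R : comNzRingType) (M : lmodType R) (m : M) :
  cyclic_submodule m m.
Proof. by exists 1; rewrite ?scale1r. Qed.

(** A nonzero submodule of [Rm] contains some [r *: m <> 0], and it is all of [Rm] as soon as that
    multiple gives [m] back. *)
Lemma simple_cyclicP (R : comNzRingType) (M : lmodType R) (m : M) : m <> 0 ->
  simple_submodule (cyclic_submodule m) <->
  forall r, r *: m <> 0 -> exists s, s *: (r *: m) = m.
Proof.
move=> m0; split=> [[_ _ simple_m] r rm0 | gen].
  have [||rm_eq0|rm_eq] := simple_m (cyclic_submodule (r *: m)).
  - exact: cyclic_is_submodule.
  - by move=> _ [s _ <-]; exists (s * r); rewrite ?scalerA.
  - by case: rm0; have := mem_cyclic (r *: m); rewrite rm_eq0.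
  - by have := mem_cyclic m; rewrite -rm_eq => -[s _ srm]; exists s.
split; first exact: cyclic_is_submodule.
  by move=> m_eq0; apply: m0; have := mem_cyclic m; rewrite m_eq0.
move=> L [L0 Llin] sub_L.
have [L_0|/existsNP[u /not_implyP[Lu u0]]] := pselect (L `<=` [set 0]).
  by left; apply/seteqP; split=> // _ ->; apply: set_mem.
right; apply/seteqP; split=> // _ [t _ <-].
have [r _ ru] := sub_L _ Lu; move: Lu u0; rewrite -ru => Lrm /gen[s srm].
(* The added 0 gives the term the shape [a *: u + v] of the closure condition. *)
have -> : t *: m = (t * s) *: (r *: m) + 0 by rewrite addr0 -scalerA srm.
by apply/set_mem/Llin => //; apply/mem_set.
Qed.

Lemma pseudo_simple_cyclics (R : comNzRingType) (M : lmodType R) :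
  cyclics_simple M -> pseudo_simple M.
Proof. by move=> simp m m0 _; apply/simple_cyclicP => // r; apply: simp. Qed.

Lemma cyclics_simple_pseudo (R : comNzRingType) (M : lmodType R) :
  ~ cyclic_module M -> pseudo_simple M -> cyclics_simple M.
Proof.
move=> ncycM psM m r rm0.
have m0 : m <> 0 by move=> m0; apply: rm0; rewrite m0 scaler0.
have /(psM _ m0)/(simple_cyclicP m0) : cyclic_submodule m <> [set: M].
  by move=> mT; apply: ncycM; exists m.
exact.
Qed.

(** Meant for the two projections: a product is noncyclic once one factor is. *)
Lemma cyclic_module_surj (R : comNzRingType) (M N : lmodType R)
    (f : {linear M -> N}) :
  (forall y, exists x, f x = y) -> cyclic_module M -> cyclic_module N.
Proof.
move=> fsurj [m mT]; exists (f m); apply/seteqP; split=> // y _.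
have [x <-] := fsurj y; have : [set: M] x by [].
by rewrite -mT => -[r _ <-]; exists r; rewrite ?linearZ.
Qed.

Lemma ann_ideal (R : comNzRingType) (M : lmodType R) :
  nonzero_module M -> idealr_closed [in ann M].
Proof.
move=> [m m0]; split.
- by apply: mem_set => x; rewrite scale0r.
- by apply/negP => /set_mem/(_ m); rewrite scale1r.
move=> a u v /set_mem ann_u /set_mem ann_v; apply: mem_set => x.
by rewrite scalerDl -scalerA ann_u ann_v scaler0 addr0.
Qed.

(** If [j] in a proper ideal [J] above [ann M] had [j *: x <> 0], some [s] would satisfy
    [s *: (j *: x) = x]. Then [1 - s * j] kills [x], so it lies in [ann M], hence in [J], and [J]
    contains 1. *)
Lemma ann_maximal (R : comNzRingType) (M : lmodType R) :
  nonzero_module M -> cyclics_simple M ->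
  (forall (x : M) r, x <> 0 -> r *: x = 0 -> ann M r) ->
  maximal_ideal (ann M).
Proof.
move=> M0 simpM ann_pt; split; first exact: ann_ideal.
move=> J [_ J1 Jlin] annJ; apply/seteqP; split=> // j Jj x.
apply: contrapT => jx0; have [s sjx] := simpM _ _ jx0.
case/negP: J1; rewrite -(subrKC (s * j) 1) addrC addrC.
apply: Jlin; first exact: mem_set.
apply/mem_set/annJ/(ann_pt x) => [x0|]; first by apply: jx0; rewrite x0 scaler0.
by rewrite scalerBl scale1r -scalerA sjx subrr.
Qed.

Lemma maximal_ideal_unit (R : comNzRingType) (I : set R) (r : R) :
  maximal_ideal I -> ~ I r -> exists s, I (1 - s * r).
Proof.
move=> [[I0 I1 Ilin] Imax] nIr; apply: contrapT => noinv; apply: nIr.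
(* This set is the ideal [I + Rr]. It contains [r], and it is proper exactly because [r] is assumed
   to have no inverse modulo [I]. *)
rewrite -(Imax [set x | exists s, I (x - s * r)]).
- by exists 1; rewrite mul1r subrr; apply: set_mem.
- split; first by apply: mem_set; exists 0; rewrite mul0r subrr; apply: set_mem.
    by apply/negP => /set_mem.
  move=> a u v /set_mem[s Is] /set_mem[t It]; apply: mem_set.
  exists (a * s + t); apply: set_mem.
  by rewrite mulrDl opprD addrACA -mulrA -mulrBr; apply: Ilin; apply: mem_set.
- by move=> x Ix; exists 0; rewrite mul0r subr0.
Qed.

Lemma cyclics_simple_maximal (R : comNzRingType) (M : lmodType R) :
  maximal_ideal (ann M) -> cyclics_simple M.
Proof.
move=> maxM m r rm0.
(* Since [r *: m <> 0], [r] lies outside [ann M] and is invertible modulo it. *)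
have [s /(_ m)] : exists s, ann M (1 - s * r).
  by apply: maximal_ideal_unit => // /(_ m).
rewrite scalerBl scale1r -scalerA => /eqP; rewrite subr_eq0 => /eqP srm.
by exists s.
Qed.

Lemma ann_prod (R : comNzRingType) (M1 M2 : lmodType R) :
  ann (M1 * M2)%type = ann M1 `&` ann M2.
Proof.
apply/seteqP; split=> [r annr | r [ann1 ann2] [x y]].
  by split=> [x|y]; [case: (annr (x, 0)) | case: (annr (0, y))].
by congr pair; [apply: ann1 | apply: ann2].
Qed.

Lemma cyclics_simple_prod_ann (R : comNzRingType) (M1 M2 : lmodType R)
    (x : M1) (y : M2) (r : R) :
  cyclics_simple (M1 * M2)%type -> x <> 0 -> y <> 0 ->
  r *: x = 0 <-> r *: y = 0.
Proof.
move=> simp x0 y0; split=> [rx|ry]; apply: contrapT => nz;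
  have [[]//|s [sx sy]] := simp (x, y) r.
- by apply: x0; rewrite -sx /= rx scaler0.
- by apply: y0; rewrite -sy /= ry scaler0.
Qed.

Theorem theorem9 (R : comNzRingType) (M1 M2 : lmodType R)
    (hM1 : nonzero_module M1) (hM2 : nonzero_module M2)
    (hnc : ~ cyclic_module M1 \/ ~ cyclic_module M2) :
  pseudo_simple (M1 * M2)%type <->
  [/\ pseudo_simple M1,
      pseudo_simple M2,
      ann M1 = ann M2 &
      maximal_ideal (ann M1)].
Proof.
split=> [psM | [_ _ ann12 max1]]; last first.
  apply/pseudo_simple_cyclics/cyclics_simple_maximal.
  by rewrite ann_prod -ann12 setIid.
have ncycM : ~ cyclic_module (M1 * M2)%type.
  move=> cycM; case: hnc; apply.
    by apply: (@cyclic_module_surj _ _ _ fst) cycM => x; exists (x, 0).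
  by apply: (@cyclic_module_surj _ _ _ snd) cycM => y; exists (0, y).
have simpM := cyclics_simple_pseudo ncycM psM.
have simp1 : cyclics_simple M1.
  move=> x r rx0; have [[]//|s [srx _]] := simpM (x, 0) r.
  by exists s.
have simp2 : cyclics_simple M2.
  move=> y r ry0; have [[]//|s [_ sry]] := simpM (0, y) r.
  by exists s.
have annE x y r := @cyclics_simple_prod_ann R M1 M2 x y r simpM.
have [[x1 x1_0] [x2 x2_0]] := (hM1, hM2).
(* [annE] compares annihilators only across the factors, so two elements of [M1] are compared
   through the fixed [x2] in [M2]. *)
have ann1 (x : M1) r : x <> 0 -> r *: x = 0 -> ann M1 r.
  move=> x0 /(annE x x2 r x0 x2_0) rx2 z.
  by have [->|/eqP z0] := eqVneq z 0; [rewrite scaler0 | apply/(annE z x2)].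
split; [exact: pseudo_simple_cyclics | exact: pseudo_simple_cyclics | | ].
  apply/seteqP; split=> [r r1 y | r r2].
    have [->|/eqP y0] := eqVneq y 0; first by rewrite scaler0.
    by apply/(annE x1 y).
  by apply: (ann1 x1) => //; apply/(annE x1 x2).
exact: ann_maximal.
Qed.
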